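(* For every integer $k\ge 1$ and every function $t=o(n)$, $B_{k+1}(0)\setminus B_k(t)\neq\emptyset$. That is, there is a distributed language $\mathcal{L}$ that has a zero-round randomized $(p,q)$-decider for some constants $p,q\in(0,1]$ with $p^{1+1/(k+1)}+q>1$, but has no randomized $(p,q)$-decider running in at most $t$ rounds for any constants $p,q\in(0,1]$ with $p^{1+1/k}+q>1$.
   Context: Model ($\mathcal{LOCAL}$). The network is a connected graph $G$ on $n$ nodes. An identity assignment $\mathrm{Id}$ gives distinct integers to the nodes. All nodes start simultaneously, run the same algorithm, and proceed in fault-free synchronous rounds; in each round every node sends messages of unlimited size to its neighbors, receives the messages of its neighbors, and performs arbitrary local computations. Initially a node knows only its identity and its local input (in particular not $n$). Each node eventually terminates and outputs ''yes'' or ''no''; the number of rounds may vary among nodes. In $t$ rounds, the output of a node depends only on the radius-$t$ neighborhood around it (structure, identities, inputs, and random bits). In a randomized algorithm, each node may in addition generate private, mutually independent random bits at any round. Languages. Let $\Sigma$ be a finite or infinite set of symbols. An instance is a pair $(G,\mathbf{x})$ where $G$ is a connected $n$-node graph and $\mathbf{x}\in\Sigma^n$ assigns to each node $v$ a local input $\mathbf{x}(v)\in\Sigma$; instances are regarded as input-labelled graphs, up to isomorphism. A distributed language $\mathcal{L}$ is a decidable collection of instances. Deciders. For constants $p,q\in(0,1]$, a randomized algorithm is a $(p,q)$-decider for $\mathcal{L}$ if for every instance $(G,\mathbf{x})$ and every identity assignment $\mathrm{Id}$, every node eventually terminates with output ''yes'' or ''no'', and: if $(G,\mathbf{x})\in\mathcal{L}$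 then $\Pr[\text{all nodes output ''yes''}]\ge p$; if $(G,\mathbf{x})\notin\mathcal{L}$ then $\Pr[\text{at least one node outputs ''no''}]\ge q$. Its running time on $(G,\mathbf{x},\mathrm{Id})$ is the maximum, over all nodes and all coin tosses, of the number of rounds until termination. For a function $t$ of triplets $(G,\mathbf{x},\mathrm{Id})$, $\mathrm{BPLD}(t,p,q)$ is the class of languages having a $(p,q)$-decider with running time at most $t(G,\mathbf{x},\mathrm{Id})$ on every $(G,\mathbf{x},\mathrm{Id})$. Here $t=o(n)$ means that $t(G,\mathbf{x},\mathrm{Id})/n\to0$ uniformly over triplets on $n$-node graphs as $n\to\infty$. For a positive integer $k$, $B_k(t)=\bigcup_{p,q\in(0,1],\ p^{1+1/k}+q>1}\mathrm{BPLD}(t,p,q)$. *)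

(* Defs.v *)
From HB Require Import structures.
From mathcomp Require Import all_boot all_order all_algebra.
From mathcomp Require Import all_classical all_reals all_analysis.

Set Implicit Arguments.
Unset Strict Implicit.
Unset Printing Implicit Defensive.

Import Order.TTheory GRing.Theory Num.Theory.
Import numFieldNormedType.Exports.

Local Open Scope classical_set_scope.
Local Open Scope ring_scope.

(* Symbols are coded by natural numbers: an alphabet, finite or infinite, is
   a set of naturals. *)
Record instance := Instance {
  nnodes : nat;
  nnodes_gt0 : (0 < nnodes)%N;
  adj : rel 'I_nnodes;
  adj_sym : symmetric adj;
  adj_irr : irreflexive adj;
  adj_connected : forall u v, connect adj u v;
  input : 'I_nnodes -> nat
}.

Definition isomorphic (I J : instance) : Prop :=
  exists f : 'I_(nnodes I) -> 'I_(nnodes J),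
    [/\ bijective f,
        forall u v, adj (f u) (f v) = adj u v
      & forall v, input (f v) = input v].

Definition over (Sigma : set nat) (I : instance) : Prop :=
  forall v : 'I_(nnodes I), Sigma (input v).

(* Decidability refers to Jones' WHILE language, a Turing-complete language
   whose data are binary trees.  Its primitives are cons, head and tail; a tree
   counts as true when it is not a leaf. *)
Inductive tree := Leaf | Node (l r : tree).

Definition is_node (d : tree) : bool := if d is Node _ _ then true else false.

Inductive expr :=
| Var (i : nat)
| Nil
| Cons (e1 e2 : expr)
| Hd (e : expr)
| Tl (e : expr).

Definition store := nat -> tree.

Fixpoint eval (s : store) (e : expr) : tree :=
  match e with
  | Var i => s i
  | Nil => Leaf
  | Cons e1 e2 => Node (eval s e1) (eval s e2)
  | Hd e1 => if eval s e1 is Node l _ then l else Leaf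
  | Tl e1 => if eval s e1 is Node _ r then r else Leaf
  end.

Definition update (s : store) (i : nat) (d : tree) : store :=
  fun j => if j == i then d else s j.

Inductive cmd :=
| Assign (i : nat) (e : expr)
| Seq (c1 c2 : cmd)
| While (e : expr) (c : cmd).

Inductive exec : cmd -> store -> store -> Prop :=
| exec_assign i e s : exec (Assign i e) s (update s i (eval s e))
| exec_seq c1 c2 s s' s'' :
    exec c1 s s' -> exec c2 s' s'' -> exec (Seq c1 c2) s s''
| exec_stop e c s : ~~ is_node (eval s e) -> exec (While e c) s s
| exec_loop e c s s' s'' :
    is_node (eval s e) -> exec c s s' -> exec (While e c) s' s'' ->
    exec (While e c) s s''.

(* Variable 0 holds the argument at the start and the answer at the end. *)
Definition computes (c : cmd) (d : tree) (b : bool) : Prop :=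
  exists2 s, exec c (update (fun=> Leaf) 0 d) s & is_node (s 0%N) = b.

Definition tree_of_nat (m : nat) : tree := iter m (Node Leaf) Leaf.

Definition tree_of_seq (s : seq tree) : tree := foldr Node Leaf s.

(* number of nodes, adjacency matrix row by row, inputs; numbers in unary *)
Definition tree_of_instance (I : instance) : tree :=
  let V := enum 'I_(nnodes I) in
  tree_of_seq
    [:: tree_of_nat (nnodes I);
        tree_of_seq
          [seq tree_of_seq [seq tree_of_nat (adj u v) | v <- V] | u <- V];
        tree_of_seq [seq tree_of_nat (input v) | v <- V]].

Definition decidable_collection (L : set instance) : Prop :=
  exists c : cmd, forall I : instance,
    computes c (tree_of_instance I) `[< L I >].

Record language := Language {
  alphabet : set nat;
  members : set instance;
  members_over : forall I, members I -> over alphabet I;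
  members_iso : forall I J, isomorphic I J -> members I -> members J;
  members_decidable : decidable_collection members
}.

Record triplet := Triplet {
  inst :> instance;
  ident : 'I_(nnodes inst) -> int;
  ident_inj : injective ident
}.

(* In every round a node generates finitely many random bits (as many as its
   state prescribes), computes, and broadcasts a message to its neighbors.
   Messages reach the receiver indexed by the identity of the sender: messages
   being of unlimited size, they may always contain that identity.  For the same
   reason broadcast is no restriction, as a message may be a function of the
   identity of the receiver. *)
Record algorithm := Algorithm {
  state : Type;
  message : Type;
  init : int -> nat -> state;
  draw : state -> nat;
  compute : state -> seq bool -> state;
  send : state -> message;
  receive : state -> (int -> option message) -> state;
  out : state -> option bool
}.

(* w v r i is the i-th random bit available to node v in round r. *)
Definition coins (n : nat) := 'I_n -> nat -> nat -> bool.

Section Execution.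
Variables (A : algorithm) (T : triplet).
Notation V := 'I_(nnodes T).

Definition inbox (s : V -> state A) (v : V) : int -> option (message A) :=
  fun z => if [pick u | adj v u && (ident u == z)] is Some u
           then Some (send (s u)) else None.

Definition local (w : coins (nnodes T)) (r : nat) (v : V) (s : state A) :
    state A :=
  compute s (mkseq (w v r) (draw s)).

(* run w r v is the state of v once it has exchanged messages r times, and
   computed from them. *)
Fixpoint run (w : coins (nnodes T)) (r : nat) : V -> state A :=
  match r with
  | 0%N => fun v => local w 0 v (init A (ident v) (input v))
  | r'.+1 => fun v => local w r'.+1 v
                        (receive (run w r' v) (inbox (run w r') v))
  end.

(* The first output is final: v terminates with output b after r rounds.  A
   node that has terminated goes on forwarding messages, so that r rounds give
   access to the whole radius-r neighborhood; an algorithm in which terminated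
   nodes fall silent is the special case where they send a dummy message. *)
Definition terminates (w : coins (nnodes T)) (v : V) (r : nat) (b : bool) :
    Prop :=
  out (run w r v) = Some b /\ forall r', (r' < r)%N -> out (run w r' v) = None.

Definition outputs (w : coins (nnodes T)) (v : V) (b : bool) : Prop :=
  exists r, terminates w v r b.

Definition all_yes : set (coins (nnodes T)) :=
  [set w | forall v, outputs w v true].

Definition some_no : set (coins (nnodes T)) :=
  [set w | exists v, outputs w v false].

End Execution.

Section Classes.
Variable R : realType.

Definition tosses n N := {ffun 'I_n * 'I_N.+1 * 'I_N.+1 -> bool}.

Definition coins_of n N (w : tosses n N) : coins n :=
  fun v r i => w (v, inord r, inord i).

Definition frequency n (E : set (coins n)) (N : nat) : R :=
  (\sum_(w : tosses n N) (`[< E (coins_of w) >] : bool)%:R)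
  / #|tosses n N|%:R.

(* Probability of an event over independent fair coins.  It is used for events
   that depend on finitely many coins only: when all nodes terminate for all
   coin tosses, so do all_yes and some_no, by compactness.  For such an event
   the sequence of frequencies is eventually constant, and equal to its
   probability. *)
Definition Pr n (E : set (coins n)) : R := limn (frequency E).

Definition decider (p q : R) (L : language) (A : algorithm) : Prop :=
  forall T : triplet, over (alphabet L) T ->
    [/\ forall w v, exists b, @outputs A T w v b,
        members L T -> p <= Pr (@all_yes A T)
      & ~ members L T -> q <= Pr (@some_no A T)].

Definition runs_within (t : triplet -> R) (L : language) (A : algorithm) :
    Prop :=
  forall T : triplet, over (alphabet L) T ->
    forall w v r b, @terminates A T w v r b -> r%:R <= t T.

Definition BPLD (t : triplet -> R) (p q : R) : set language :=
  [set L | exists2 A, decider p q L A & runs_within t L A].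

Definition B (k : nat) (t : triplet -> R) : set language :=
  [set L | exists p q : R,
     [/\ 0 < p <= 1, 0 < q <= 1, p `^ (1 + k%:R^-1) + q > 1
       & BPLD t p q L]].

Definition sublinear (t : triplet -> R) : Prop :=
  forall e : R, 0 < e -> exists n0 : nat, forall T : triplet,
    (n0 <= nnodes T)%N -> `|t T| / (nnodes T)%:R <= e.

End Classes.

(* Main.v *)
(* The language: at most [k] nodes are selected, that is, have a nonzero input.
   If every selected node says no with probability 1/2, then p = 2^-k and
   q = 1 - 2^-(k+1), and p^(1+1/(k+1)) + q > 1.

   Conversely, take a decider on a long path.  Without selected nodes all nodes
   say yes with probability at least p, so among m distant segments, whose
   outputs are independent, one is secure: it says yes with probability at least
   1 - d, where (1-d)^m < p.  Choose k secure segments and place k+1 selected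
   nodes, separated by them.  The k+1 blocks that remain around the selected
   nodes have independent outputs; let P_i be the probability that block i says
   yes.  Unselecting the node of block i gives a yes-instance, so the product of
   the other P_j is at least p.  Hence P_0...P_k >= p^(1+1/k), and all nodes say
   yes with probability at least p^(1+1/k) - k d, which must not exceed 1 - q. *)

Require Import Defs.
From mathcomp Require Import all_boot all_order all_algebra.
From mathcomp Require Import all_classical all_reals all_analysis.
From mathcomp Require Import zify lra.

Set Implicit Arguments.
Unset Strict Implicit.
Unset Printing Implicit Defensive.

Import Order.TTheory GRing.Theory Num.Theory.
Import numFieldNormedType.Exports.

Local Open Scope classical_set_scope.
Local Open Scope ring_scope.

(** * Frequencies of coin events *)

Definition toss_of n N (w : coins n) : tosses n N :=
  [ffun z : 'I_n * 'I_N.+1 * 'I_N.+1 => w z.1.1 z.1.2 z.2].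

Definition agree_upto n N (w w' : coins n) : Prop :=
  forall v r i, (r <= N)%N -> (i <= N)%N -> w v r i = w' v r i.

(** One implication suffices, since agreement is symmetric. The same [N] bounds rounds and bit
    indices, as in [tosses]. *)
Definition depends_upto n N (E : set (coins n)) : Prop :=
  forall w w', agree_upto N w w' -> E w -> E w'.

Definition agree_on n (S : pred 'I_n) (w w' : coins n) : Prop :=
  forall v r i, S v -> w v r i = w' v r i.

Definition depends_on n (S : pred 'I_n) (E : set (coins n)) : Prop :=
  forall w w', agree_on S w w' -> E w -> E w'.

Lemma agree_upto_sym n N (w w' : coins n) :
  agree_upto N w w' -> agree_upto N w' w.
Proof. by move=> ww' v r i hr hi; rewrite ww'. Qed.

Lemma agree_on_sym n S (w w' : coins n) : agree_on S w w' -> agree_on S w' w.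
Proof. by move=> ww' v r i Sv; rewrite ww'. Qed.

Lemma depends_upto_eq n N (E : set (coins n)) w w' :
  depends_upto N E -> agree_upto N w w' -> `[< E w >] = `[< E w' >].
Proof.
move=> dE ww'; apply/asboolP/asboolP; apply: dE => //.
exact: agree_upto_sym.
Qed.

Lemma depends_on_eq n S (E : set (coins n)) w w' :
  depends_on S E -> agree_on S w w' -> `[< E w >] = `[< E w' >].
Proof.
move=> dE ww'; apply/asboolP/asboolP; apply: dE => //.
exact: agree_on_sym.
Qed.

(** The bounds in [agree_upto] matter: [inord] sends every index above [N] to 0. *)
Lemma toss_ofK n N (w : coins n) : agree_upto N (coins_of (toss_of N w)) w.
Proof. by move=> v r i hr hi; rewrite /coins_of ffunE /= !inordK. Qed.

Lemma coins_ofK n N M (w : tosses n N) : (N <= M)%N ->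
  toss_of N (coins_of (toss_of M (coins_of w))) = w.
Proof.
move=> NM; apply/ffunP => -[[v r] i]; rewrite ffunE toss_ofK /=.
- by rewrite /coins_of !inord_val.
- by have := ltn_ord r; lia.
- by have := ltn_ord i; lia.
Qed.

(* Each pattern of the first [N] coins extends to equally many patterns of the
   first [M], as xor permutes the patterns. *)
Lemma card_toss_fiber n N M (w0 w1 : tosses n N) : (N <= M)%N ->
  (#|[pred w : tosses n M | toss_of N (coins_of w) == w0]| <=
   #|[pred w : tosses n M | toss_of N (coins_of w) == w1]|)%N.
Proof.
move=> NM; have [d dE] : exists d : tosses n N, forall z, d z = w0 z (+) w1 z.
  by exists [ffun z => w0 z (+) w1 z] => z; rewrite ffunE.
pose f (w : tosses n M) : tosses n M :=
  [ffun z => w z (+) toss_of M (coins_of d) z].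
have fI : injective f.
  by move=> a b /ffunP ab; apply/ffunP => z; have := ab z; rewrite !ffunE => /addIb.
rewrite -(card_imset _ fI); apply: subset_leq_card.
apply/fintype.subsetP => w1' /imsetP[w + ->]; rewrite !inE => /eqP ww0.
apply/eqP/ffunP => z; move/ffunP : ww0 => /(_ z).
have /ffunP/(_ z) := coins_ofK d NM; rewrite /f /toss_of /coins_of !ffunE /= => -> ->.
by rewrite dE addbA addbb.
Qed.

Section Frequency.
Variable R : realType.
Implicit Types (n N : nat).

Notation frequency := (@frequency R _).

Lemma frequencyE n (E : set (coins n)) N :
  frequency E N = (\sum_(w : tosses n N) (`[< E (coins_of w) >] : bool)%:R)
                  / #|tosses n N|%:R.
Proof. by []. Qed.

Lemma card_tosses_gt0 n N : (0 : R) < #|tosses n N|%:R.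
Proof. by rewrite ltr0n card_ffun card_bool expn_gt0. Qed.

(** Sorting the tosses for [M] by their truncation to [N] multiplies both the number of favourable
    tosses and the total by the common fibre size [c]. *)
Lemma frequency_const n (E : set (coins n)) N M : depends_upto N E ->
  (N <= M)%N -> frequency E M = frequency E N.
Proof.
move=> dE NM.
pose c := #|[pred w : tosses n M | toss_of N (coins_of w) == [ffun=> false]]|.
have sumM (F : set (coins n)) : depends_upto N F ->
    \sum_(w : tosses n M) ((`[< F (coins_of w) >] : bool)%:R : R) =
    (\sum_(w : tosses n N) ((`[< F (coins_of w) >] : bool)%:R : R)) * c%:R.
  move=> dF.
  rewrite (partition_big (fun w : tosses n M => toss_of N (coins_of w)) xpredT) //=.
  rewrite mulr_suml; apply: eq_bigr => w0 _.
  transitivity (\sum_(w : tosses n M | toss_of N (coins_of w) == w0)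
                  ((`[< F (coins_of w0) >] : bool)%:R : R)).
    apply: eq_bigr => w /eqP <-; congr (_ %:R); congr nat_of_bool.
    by apply: depends_upto_eq dF _; apply: agree_upto_sym; exact: toss_ofK.
  rewrite sumr_const mulr_natr; congr (_ *+ _).
  by apply/eqP; rewrite eqn_leq !card_toss_fiber.
(* The same count for the sure event gives the total number of tosses. *)
have cardM : (#|tosses n M|%:R : R) = #|tosses n N|%:R * c%:R.
  have dT : depends_upto N [set: coins n] by [].
  have := sumM _ dT; under eq_bigr do rewrite asboolT //.
  by under [in X in _ = X -> _]eq_bigr do rewrite asboolT //; rewrite !sumr_const.
have c0 : c%:R != 0 :> R.
  by apply/eqP => c0; have := card_tosses_gt0 n M; rewrite cardM c0 mulr0 ltxx.
by rewrite !frequencyE (sumM _ dE) cardM invfM mulrACA divff // mulr1.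
Qed.

Lemma Pr_frequency n (E : set (coins n)) N : depends_upto N E ->
  Pr R E = frequency E N.
Proof.
move=> dE; apply/cvg_lim => //.
apply: cvg_near_cst; near=> M.
by apply: frequency_const => //; near: M; exact: nbhs_infty_ge.
Unshelve. all: by end_near. Qed.

Lemma frequency_ge0 n (E : set (coins n)) N : 0 <= frequency E N.
Proof. by rewrite frequencyE divr_ge0 ?sumr_ge0. Qed.

Lemma le_frequency n (E F : set (coins n)) N : E `<=` F ->
  frequency E N <= frequency F N.
Proof.
move=> EF; rewrite !frequencyE ler_wpM2r ?invr_ge0 //.
apply: ler_sum => w _; case: (asboolP (E _)) => //= Ew.
by rewrite asboolT //; exact: EF.
Qed.

Lemma frequencyT n N : frequency [set: coins n] N = 1.
Proof.
rewrite frequencyE; under eq_bigr do rewrite asboolT //.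
by rewrite sumr_const divff // gt_eqF ?card_tosses_gt0.
Qed.

Lemma frequency_le1 n (E : set (coins n)) N : frequency E N <= 1.
Proof. by rewrite -(frequencyT n N) le_frequency. Qed.

Lemma frequencyC n (E : set (coins n)) N :
  frequency (~` E) N = 1 - frequency E N.
Proof.
rewrite -(frequencyT n N) !frequencyE -mulrBl -sumrB; congr (_ / _).
apply: eq_bigr => w _; rewrite [in X in _ = X - _]asboolT //.
by rewrite asbool_neg; case: (asboolP (E _)) => _; rewrite ?subrr ?subr0.
Qed.

Lemma frequencyU n (E F : set (coins n)) N :
  frequency (E `|` F) N <= frequency E N + frequency F N.
Proof.
rewrite !frequencyE -mulrDl ler_wpM2r ?invr_ge0 // -big_split /=.
apply: ler_sum => w _; rewrite asbool_or -natrD ler_nat.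
by do 2 case: asboolP.
Qed.

(* The involution exchanging the coins outside [S] of two independent samples
   turns [E `&` F] for the first one into [E] for one and [F] for the other. *)
Lemma frequencyI n (S : pred 'I_n) (E F : set (coins n)) N :
  depends_on S E -> depends_on (predC S) F ->
  frequency (E `&` F) N = frequency E N * frequency F N.
Proof.
move=> dE dF.
pose mix (a b : tosses n N) : tosses n N :=
  [ffun z => if S z.1.1 then a z else b z].
pose h (z : tosses n N * tosses n N) := (mix z.1 z.2, mix z.2 z.1).
have hK : involutive h.
  move=> [a b]; rewrite /h /=; congr (_, _); apply/ffunP => z;
  by rewrite /mix !ffunE; case: (S _).
pose e (w : tosses n N) : R := (`[< E (coins_of w) >] : bool)%:R.
pose f (w : tosses n N) : R := (`[< F (coins_of w) >] : bool)%:R.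
(* The factor [#|tosses n N|] brings in the second independent sample on which [h] acts. *)
have key : (\sum_w e w * f w) * #|tosses n N|%:R = (\sum_w e w) * (\sum_w f w).
  transitivity (\sum_(z : tosses n N * tosses n N) e z.1 * f z.1).
    rewrite -(pair_big xpredT xpredT (fun a b => e a * f a)) /=.
    rewrite mulr_suml; apply: eq_bigr => w _.
    by rewrite sumr_const mulr_natr.
  rewrite (reindex_inj (inv_inj hK)) /=.
  rewrite mulr_suml.
  under [RHS]eq_bigr do rewrite mulr_sumr.
  rewrite (pair_big xpredT xpredT (fun a b => e a * f b)) /=.
  apply: eq_bigr => -[a b] _ /=; rewrite /e /f; congr (_ %:R * _ %:R).
    congr nat_of_bool; apply: depends_on_eq dE _ => v r i Sv.
    by rewrite /coins_of ffunE /= Sv.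
  congr nat_of_bool; apply: depends_on_eq dF _ => v r i /= /negbTE Sv.
  by rewrite /coins_of ffunE /= Sv.
have := card_tosses_gt0 n N; rewrite !frequencyE => c0.
rewrite mulrACA -key -mulrA; congr (_ * _).
  apply: eq_bigr => w _; rewrite /e /f asbool_and.
  by do 2 case: asboolP; rewrite ?mulr0 ?mul0r ?mulr1.
by rewrite mulrA divff ?mul1r // gt_eqF.
Qed.

(** Induction on [j]: the events before [E j] read only nodes labelled below [j], and [E j] only
    nodes labelled [j], so [frequencyI] applies. *)
Lemma frequency_indep n (lab : 'I_n -> nat) (E : nat -> set (coins n)) j N :
  (forall i, depends_on [pred v | lab v == i] (E i)) ->
  frequency [set w | forall i, (i < j)%N -> E i w] N =
  \prod_(i < j) frequency (E i) N.
Proof.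
move=> dE; elim: j => [|j IH].
  rewrite big_ord0; apply/eqP; rewrite eq_le frequency_le1 -(frequencyT n N).
  exact: le_frequency.
rewrite big_ord_recr /= -IH.
have -> : [set w | forall i, (i < j.+1)%N -> E i w] =
    [set w | forall i, (i < j)%N -> E i w] `&` E j.
  apply/seteqP; split => w /=.
    by move=> Ew; split=> [i ij|]; apply: Ew; lia.
  move=> [Ew Ej] i; rewrite ltnS leq_eqVlt => /orP[/eqP -> //|]; exact: Ew.
apply: (@frequencyI _ [pred v | (lab v < j)%N]).
- move=> w w' ww' Ew i ij; apply: dE (Ew i ij) => v r c /= /eqP vi.
  by apply: ww' => /=; rewrite vi.
- move=> w w' ww'; apply: dE => v r c /= /eqP vj.
  by apply: ww' => /=; rewrite vj ltnn.
Qed.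

End Frequency.

(** * Runs on paths *)

(** The number of bits a node draws depends on its state, hence by induction on finitely many coins;
    over the finitely many patterns of these there is a largest draw. *)
Lemma coins_bounded (A : algorithm) (T : triplet) r : exists N, forall w w',
  agree_upto N w w' -> forall r', (r' <= r)%N -> forall v,
  @run A T w r' v = @run A T w' r' v.
Proof.
(* [pre] is the state in a round just before its bits are drawn. *)
pose pre (w : coins (nnodes T)) r v : state A :=
  if r is r'.+1 then receive (@run A T w r' v) (inbox (@run A T w r') v)
  else init A (ident v) (input v).
have runE w r' v : @run A T w r' v = local w r' v (pre w r' v) by case: r'.
have local_bounded r' N : (forall w w', agree_upto N w w' ->
      forall v, pre w r' v = pre w' r' v) ->
    exists2 N', (N <= N')%N & forall w w', agree_upto N' w w' ->
      forall v, @run A T w r' v = @run A T w' r' v.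
  move=> pre_eq.
  pose M := (\max_(w : tosses (nnodes T) N) \max_v draw (pre (coins_of w) r' v))%N.
  (* The bound has to cover the index [r'] of the round as well as the bit indices, which stay below
     [M]. *)
  exists (maxn N (maxn M r')); first by rewrite leq_maxl.
  move=> w w' ww' v; rewrite !runE.
  have ww'N : agree_upto N w w' by move=> u x i hx hi; apply: ww'; lia.
  rewrite -(pre_eq _ _ ww'N) /local; congr compute.
  have drawM : (draw (pre w r' v) <= M)%N.
    rewrite (pre_eq _ (coins_of (toss_of N w))); last first.
      by apply: agree_upto_sym; exact: toss_ofK.
    apply: leq_trans (leq_bigmax (toss_of N w)).
    exact: (leq_bigmax (F := fun u => draw (pre _ r' u))).
  apply: (@eq_from_nth _ false); rewrite !size_mkseq // => i hi.
  by rewrite !nth_mkseq //; apply: ww'; lia.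
elim: r => [|r [N IH]].
  have [//|N _ hN] := local_bounded 0%N 0%N.
  by exists N => w w' ww' r'; rewrite leqn0 => /eqP ->; exact: hN.
have [|N' NN' hN'] := local_bounded r.+1 N.
  move=> w w' ww' v /=; rewrite (IH _ _ ww') //; congr receive.
  by congr (inbox _ v); apply/funext => u; exact: IH.
exists N' => w w' ww' r'; rewrite leq_eqVlt => /orP[/eqP ->|]; first exact: hN'.
rewrite ltnS => r'r; move=> v; apply: IH => // u x i hx hi; apply: ww'; lia.
Qed.

Lemma outputs_eq (A : algorithm) (T T' : triplet) w w' v v' b r :
  (forall r', (r' <= r)%N -> @run A T w r' v = @run A T' w' r' v') ->
  (forall r' b, @terminates A T w v r' b -> (r' <= r)%N) ->
  @outputs A T w v b -> @outputs A T' w' v' b.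
Proof.
move=> run_eq tr [r' tb]; have r'r := tr _ _ tb.
case: tb => ob nb; exists r'; split; first by rewrite -run_eq.
move=> r'' hr''; rewrite -run_eq; [exact: nb | lia].
Qed.

Lemma outputs_inj (A : algorithm) (T : triplet) w v b b' :
  @outputs A T w v b -> @outputs A T w v b' -> b = b'.
Proof.
move=> [r [rb rN]] [s [sb sN]]; case: (ltngtP r s) => [rs|sr|rs].
- by have := sN _ rs; rewrite rb.
- by have := rN _ sr; rewrite sb.
- by move: sb; rewrite -rs rb => -[].
Qed.

Lemma some_noE (A : algorithm) (T : triplet) :
  (forall w v, exists b, @outputs A T w v b) ->
  @some_no A T = ~` @all_yes A T.
Proof.
move=> tot; apply/seteqP; split => w /=.
  by move=> [v no] /(_ v) yes; have := outputs_inj no yes.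
move=> nyes; apply: contrapT => nno; apply: nyes => v.
have [[] // no] := tot w v; by case: nno; exists v.
Qed.

Section Path.
Variables (n : nat) (n_gt0 : (0 < n)%N).
Implicit Types (x : 'I_n -> nat).

Definition path_adj (u v : 'I_n) : bool := (u.+1 == v) || (v.+1 == u).

Lemma path_adj_sym : symmetric path_adj.
Proof. by move=> u v; rewrite /path_adj orbC. Qed.

Lemma path_adj_irr : irreflexive path_adj.
Proof. by move=> u; rewrite /path_adj; lia. Qed.

Lemma path_adj_connected u v : connect path_adj u v.
Proof.
suff from0 w : connect path_adj (Ordinal n_gt0) w.
  apply: (connect_trans _ (from0 v)).
  by rewrite (sym_connect_sym path_adj_sym).
case: w => m; elim: m => [|m IH] hm.
  by apply/eq_connect0/val_inj.
apply: connect_trans (IH (ltnW hm)) _.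
by apply: connect1; rewrite /path_adj eqxx.
Qed.

Definition path_instance x : instance :=
  @Instance n n_gt0 path_adj path_adj_sym path_adj_irr path_adj_connected x.

(** Identities do not depend on the selection, so that runs for different selections can be compared
    node by node. *)
Definition path_ident (v : 'I_n) : int := (v : nat)%:Z.

Lemma path_ident_inj : injective path_ident.
Proof. by move=> u v [] /val_inj. Qed.

Definition path_triplet x : triplet :=
  @Triplet (path_instance x) path_ident path_ident_inj.

(** Distance at most [r] along the path, written without truncated subtraction. *)
Definition path_near r (u v : 'I_n) : bool := (u <= v + r)%N && (v <= u + r)%N.

(** Information crosses one edge per round: the radius-[r] balls around the neighbours of [v] lie in
    the radius-[r.+1] ball around [v]. *)
Lemma path_run_local (A : algorithm) r v x x' (w w' : coins n) :
  (forall u, path_near r u v -> x u = x' u) ->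
  agree_on [pred u | path_near r u v] w w' ->
  @run A (path_triplet x) w r v = @run A (path_triplet x') w' r v.
Proof.
elim: r v => [|r IH] v xx' ww'.
  rewrite /= /local /= xx' ?/path_near ?addn0 ?leqnn //; congr compute.
  by apply: eq_mkseq => i; apply: ww'; rewrite /= /path_near addn0 leqnn.
have run_eq u : path_near 1 u v ->
    @run A (path_triplet x) w r u = @run A (path_triplet x') w' r u.
  move=> uv; apply: IH => [y yu|y i j yu]; [apply: xx' | apply: ww'];
  move: yu uv; rewrite /= /path_near; lia.
have vv : path_near 1 v v by rewrite /path_near; lia.
rewrite /= run_eq // /local.
have -> : inbox (@run A (path_triplet x) w r) v =
          inbox (@run A (path_triplet x') w' r) v.
  apply/funext => z; rewrite /inbox /=; case: pickP => // u /andP[uv _].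
  by rewrite run_eq // /path_near; move: uv; rewrite /path_adj; lia.
congr compute; apply: eq_mkseq => i; apply: ww'.
by rewrite /= /path_near; lia.
Qed.

End Path.

(** * The selection language *)

Definition selected (I : instance) : nat := #|[pred v | input (i := I) v != 0%N]|.

Definition at_most_selected (k : nat) : set instance :=
  [set I | (selected I <= k)%N].

Lemma selected_iso I J : isomorphic I J -> selected J = selected I.
Proof.
move=> [f [fB _ finput]].
have fI : injective f by exact: bij_inj.
rewrite /selected -(fintype.card_image fI [pred v | input v != 0%N]).
apply: eq_card => v; have [g fK gK] := fB.
by rewrite inE -[v]gK fintype.mem_image // inE finput.
Qed.

(** * Decidability by a WHILE program *)

Fixpoint unary_expr (m : nat) : expr :=
  if m is m'.+1 then Defs.Cons Defs.Nil (unary_expr m') else Defs.Nil.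

Lemma eval_unary_expr s m : Defs.eval s (unary_expr m) = tree_of_nat m.
Proof. by elim: m => //= m ->. Qed.

(* Variable 0 runs through the inputs, variable 1 is the number of selected
   nodes that are still tolerated, plus one. *)
Definition selection_body : cmd :=
  Seq (Assign 2 (Hd (Var 0)))
    (Seq (While (Var 2) (Seq (Assign 1 (Tl (Var 1))) (Assign 2 Defs.Nil)))
         (Assign 0 (Tl (Var 0)))).

Definition selection_program (k : nat) : cmd :=
  Seq (Assign 0 (Hd (Tl (Tl (Var 0)))))
    (Seq (Assign 1 (unary_expr k.+1))
      (Seq (While (Var 0) selection_body) (Assign 0 (Var 1)))).

(** The inner [While] is a conditional: its guard, variable 2, is cleared in the first iteration.
    The tail of a leaf is a leaf, which matches truncated subtraction. *)
Lemma exec_selection_body s m d c :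
  s 0%N = Node (tree_of_nat m) d -> s 1%N = tree_of_nat c ->
  exists s', [/\ exec selection_body s s', s' 0%N = d &
                 s' 1%N = tree_of_nat (c - (m != 0%N))].
Proof.
move=> s0 s1; case: m => [|m] in s0 *.
  exists (update (update s 2 Leaf) 0 d); split => //; last first.
    by rewrite /update /= subn0.
  have -> : update s 2 Leaf = update s 2 (Defs.eval s (Hd (Var 0))) by rewrite /= s0.
  apply: exec_seq; first exact: exec_assign.
  apply: exec_seq; first by apply: exec_stop; rewrite /= /update /= s0.
  have e0 s2 : s2 0%N = s 0%N -> update s2 0 d = update s2 0 (Defs.eval s2 (Tl (Var 0))).
    by move=> /= ->; rewrite s0.
  by rewrite [X in exec _ _ X]e0 //; exact: exec_assign.
pose s2 := update s 2 (Defs.eval s (Hd (Var 0))).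
pose s3 := update s2 1 (Defs.eval s2 (Tl (Var 1))).
pose s4 := update s3 2 (Defs.eval s3 Defs.Nil).
exists (update s4 0 (Defs.eval s4 (Tl (Var 0)))); split.
- apply: exec_seq; first exact: exec_assign.
  apply: exec_seq; last exact: exec_assign.
  apply: (@exec_loop _ _ _ s4); last exact: exec_stop.
    by rewrite /= /update /= s0.
  by apply: exec_seq; exact: exec_assign.
- by rewrite /= /s4 /s3 /s2 /update /= s0.
- by rewrite /= /s4 /s3 /s2 /update /= s1 subn1; case: (c).
Qed.

Lemma exec_selection_loop (l : seq nat) s c :
  s 0%N = tree_of_seq (map tree_of_nat l) -> s 1%N = tree_of_nat c ->
  exists2 s', exec (While (Var 0) selection_body) s s' &
              s' 1%N = tree_of_nat (c - count (fun m => m != 0%N) l).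
Proof.
elim: l s c => [|m l IH] s c /= s0 s1.
  by exists s; rewrite ?subn0 //; apply: exec_stop; rewrite /= s0.
have [s' [es s'0 s'1]] := exec_selection_body s0 s1.
have [s'' es' s''1] := IH _ _ s'0 s'1.
exists s''; last by rewrite s''1 subnDA.
by apply: exec_loop es es'; rewrite /= s0.
Qed.

Lemma at_most_selected_decidable k : decidable_collection (at_most_selected k).
Proof.
exists (selection_program k) => I; rewrite /computes.
set s := update _ _ _.
pose s1 := update s 0 (Defs.eval s (Hd (Tl (Tl (Var 0))))).
pose s2 := update s1 1 (Defs.eval s1 (unary_expr k.+1)).
have s20 : s2 0%N = tree_of_seq (map tree_of_nat [seq input v | v <- enum 'I_(nnodes I)]).
  by rewrite -map_comp.
have s21 : s2 1%N = tree_of_nat k.+1 by rewrite /s2 eval_unary_expr.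
have [s3 es3 s31] := exec_selection_loop s20 s21.
exists (update s3 0 (Defs.eval s3 (Var 1))).
  apply: exec_seq; first exact: exec_assign.
  apply: exec_seq; first exact: exec_assign.
  by apply: exec_seq es3 _; exact: exec_assign.
rewrite /update /= s31 count_map.
have -> : count (preim (input (i := I)) (fun m => m != 0%N))
    (enum 'I_(nnodes I)) = selected I.
  by rewrite /selected cardE {2}/enum_mem size_filter enumT; apply: eq_count.
(* The counter started at [k.+1], so it is still positive exactly when at most [k] nodes are
   selected. *)
have -> : is_node (tree_of_nat (k.+1 - selected I)) = (selected I <= k)%N.
  rewrite -ltnS -subn_gt0; by case: (_ - _)%N.
by apply/esym; apply/asboolP/idP.
Qed.

Definition selection_language (k : nat) : language :=
  @Language [set: nat] (at_most_selected k) (fun _ _ _ => I)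
    (fun I J IJ (hI : (selected I <= k)%N) =>
       eq_ind_r (fun m => (m <= k)%N) hI (selected_iso IJ))
    (at_most_selected_decidable k).

(* The state pairs the selection mark with the answer. *)
Definition selection_algorithm : algorithm :=
  @Algorithm (bool * option bool) unit
    (fun _ x => (x != 0%N, None))
    (fun s => s.1)
    (fun s bits => (s.1, Some (~~ s.1 || head true bits)))
    (fun _ => tt) (fun s _ => s) snd.

(** Bits are drawn already in round 0. The selection mark, read as a number, asks for one bit at
    selected nodes and none elsewhere. *)
Lemma selection_terminates (T : triplet) w (v : 'I_(nnodes T)) r b :
  @terminates selection_algorithm T w v r b <->
  r = 0%N /\ b = (input v != 0%N) ==> w v 0%N 0%N.
Proof.
have out0 : out (@run selection_algorithm T w 0 v) =
    Some ((input v != 0%N) ==> w v 0%N 0%N).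
  by rewrite /= /local /=; case: (input v).
split=> [[ob h]|[-> ->]]; last by split.
case: r ob h => [|r] ob h; first by move: ob; rewrite out0 => -[<-].
by have := h 0%N isT; rewrite out0.
Qed.

Lemma selection_outputs (T : triplet) w (v : 'I_(nnodes T)) b :
  @outputs selection_algorithm T w v b <->
  b = (input v != 0%N) ==> w v 0%N 0%N.
Proof.
split=> [[r /selection_terminates[]] //|->].
by exists 0%N; apply/selection_terminates.
Qed.

(** The indicator of [all_yes] is a product over single coins. A coin that decides the answer of a
    selected node contributes 1/2, any other coin contributes 1. *)
Lemma selection_frequency (R : realType) (T : triplet) N :
  frequency R (@all_yes selection_algorithm T) N = 2^-1 ^+ selected T.
Proof.
pose X : finType := ('I_(nnodes T) * 'I_N.+1 * 'I_N.+1)%type.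
pose tossed (z : X) := [&& input z.1.1 != 0%N, z.1.2 == ord0 & z.2 == ord0].
pose F (z : X) (b : bool) : R := (tossed z ==> b)%:R.
have inord00 : inord 0 = ord0 :> 'I_N.+1 by apply/val_inj; rewrite /= inordK.
have -> : frequency R (@all_yes selection_algorithm T) N =
    (\sum_(w : {ffun X -> bool}) \prod_z F z (w z)) / #|{ffun X -> bool}|%:R.
  rewrite frequencyE; congr (_ / _); apply: eq_bigr => w _.
  case: asboolP => [yes|nyes].
    rewrite big1 // => -[[v r] i] _; rewrite /F (_ : _ ==> _) //.
    apply/implyP => /and3P[/= sv /eqP -> /eqP ->].
    have /selection_outputs := yes v.
    by rewrite sv /coins_of inord00 /= => <-.
  apply/esym/eqP/prodf_eq0; apply: contrapT => nz; apply: nyes => v.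
  apply/selection_outputs/esym/implyP => sv.
  apply: contrapT => /negP wv; apply: nz.
  exists (v, ord0, ord0) => //; rewrite /F /tossed /= sv !eqxx /= pnatr_eq0 eqb0.
  by move: wv; rewrite /coins_of inord00.
(* The sum over all tosses of a product becomes a product of sums over one coin each. *)
rewrite -(bigA_distr_bigA F) card_ffun card_bool natrX.
have -> : 2 ^+ #|X| = \prod_(z : X) (2 : R) by rewrite prodr_const.
rewrite -prodf_div.
transitivity (\prod_(z | tossed z) (2^-1 : R)).
  rewrite [RHS]big_mkcond /=; apply: eq_bigr => z _.
  rewrite big_bool /F; case: (tossed z) => /=; first by rewrite addr0 mul1r.
  by rewrite -[1 + 1]/(2%:R) divff.
rewrite prodr_const /selected; congr (_ ^+ _).
have sI : injective (fun v : 'I_(nnodes T) => (v, ord0, ord0) : X) by move=> u v [].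
rewrite -(fintype.card_image sI [pred v | input v != 0%N]).
apply: eq_card => -[[v r] i]; apply/and3P/fintype.imageP.
  by move=> [/= sv /eqP -> /eqP ->]; exists v.
by move=> [u su [-> -> ->]]; split=> //; rewrite eqxx.
Qed.

Lemma selection_Pr (R : realType) (T : triplet) :
  Pr R (@all_yes selection_algorithm T) = 2^-1 ^+ selected T.
Proof.
apply/cvg_lim => //.
have -> : frequency R (@all_yes selection_algorithm T) = fun=> 2^-1 ^+ selected T.
  by apply/funext => N; exact: selection_frequency.
exact: cvg_cst.
Qed.

Lemma selection_Pr_no (R : realType) (T : triplet) :
  Pr R (@some_no selection_algorithm T) = 1 - 2^-1 ^+ selected T.
Proof.
have tot w v : exists b, @outputs selection_algorithm T w v b.
  by eexists; apply/selection_outputs.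
apply/cvg_lim => //.
have -> : frequency R (@some_no selection_algorithm T) = fun=> 1 - 2^-1 ^+ selected T.
  by apply/funext => N; rewrite some_noE // frequencyC selection_frequency.
exact: cvg_cst.
Qed.

Lemma selection_language_B (R : realType) k : (1 <= k)%N ->
  B k.+1 (fun=> 0 : R) (selection_language k).
Proof.
move=> k1.
have h0 : (0 : R) < 2^-1 by lra.
have h1 : (2^-1 : R) < 1 by lra.
have h0' : (0 : R) <= 2^-1 by lra.
have h1' : (2^-1 : R) <= 1 by lra.
exists (2^-1 ^+ k), (1 - 2^-1 ^+ k.+1); split.
- by rewrite exprn_gt0 // exprn_ile1.
- by rewrite subr_gt0 exprn_ilt1 //= gerBl exprn_ge0.
(* After raising to the power [k.+1], the claim compares exponents of 1/2: [k * (k + 2)] is one less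
   than [(k + 1) ^ 2]. *)
- rewrite addrCA ltrDl subr_gt0.
  rewrite -(@ltr_pXn2r _ k.+1) // ?nnegrE ?powR_ge0 ?exprn_ge0 //.
  rewrite -[ltRHS]powR_mulrn ?powR_ge0 // -powRrM mulrDl mul1r mulVf ?pnatr_eq0 //.
  rewrite natr1 powR_mulrn ?exprn_ge0 // -!exprM ltr_iXn2l //; lia.
- exists selection_algorithm.
    move=> T _; split.
    + by move=> w v; eexists; apply/selection_outputs.
    + by move=> hT; rewrite selection_Pr ler_wiXn2l.
    + move=> /negP hT; rewrite selection_Pr_no lerD2l lerN2 ler_wiXn2l //.
      by rewrite ltnNge.
  by move=> T _ w v r b /selection_terminates[-> _].
Qed.

(** * Separation on a long path *)

Lemma leq_cell W a b : (a < b)%N -> (W * a + W <= W * b)%N.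
Proof. by move=> ab; rewrite addnC -mulnS leq_mul2l ab orbT. Qed.

Lemma cell_div W a u : (W * a <= u < W * a + W)%N -> (u %/ W)%N = a.
Proof.
move=> /andP[au ua].
have W0 : (0 < W)%N by lia.
rewrite -(subnKC au) mulnC divnMDl // divn_small ?addn0 //; lia.
Qed.

Lemma sum_ltn_ord k i : (i <= k)%N -> (\sum_(g < k) (g < i))%N = i.
Proof.
have -> : (\sum_(g < k) (g < i))%N = minn k i.
  elim: k => [|k IH]; first by rewrite big_ord0 min0n.
  by rewrite big_ord_recr IH /=; lia.
by move/minn_idPr.
Qed.

Section RealBounds.
Variable R : realType.

Lemma expr_lt_exists (x y : R) : 0 <= x < 1 -> 0 < y -> exists m, x ^+ m < y.
Proof.
move=> /andP[x0 x1] y0.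
have xm : x ^+ m @[m --> \oo] --> (0 : R) by apply: cvg_expr; rewrite ger0_norm.
have [m _ hm] := cvgr_lt _ xm _ y0.
by exists m; apply: hm => /=.
Qed.

(** Let Q be the full product. Multiplying the bounds [P i * p <= Q] over all [i] gives
    [Q * p ^ (k + 1) <= Q ^ (k + 1)]; cancel Q and take [k]-th roots. *)
Lemma prod_except_powR k (P : 'I_k.+1 -> R) (p : R) : (0 < k)%N -> 0 < p ->
  (forall i, 0 <= P i) -> (forall i0, p <= \prod_(i | i != i0) P i) ->
  p `^ (1 + k%:R^-1) <= \prod_i P i.
Proof.
move=> k0 p0 P_ge0 pP.
(* As [k] is positive there is another index [i'], and [P i] is a factor of the positive product
   that omits [i']. *)
have P_gt0 i : 0 < P i.
  have [i' ii'] : exists i', i != i'.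
    exists (if i == ord0 then ord_max else ord0).
    case: (eqVneq i ord0) => [->|//]; rewrite -val_eqE /=; lia.
  rewrite lt0r P_ge0 andbT; have /lt0r_neq0 := lt_le_trans p0 (pP i').
  by move/prodf_neq0 => /(_ i ii').
have Q_gt0 : 0 < \prod_i P i by apply: prodr_gt0.
have pQ i : P i * p <= \prod_i P i.
  by rewrite (bigD1 i) //= ler_wpM2l.
have : \prod_i (P i * p) <= \prod_(i < k.+1) \prod_i P i.
  by apply: ler_prod => i _; rewrite pQ mulr_ge0 // ltW.
rewrite big_split /= !prodr_const card_ord [leRHS]exprS ler_pM2l // => pkQ.
rewrite -(@ler_pXn2r _ k) ?nnegrE ?powR_ge0 ?(ltW Q_gt0) //.
rewrite -powR_mulrn ?powR_ge0 // -powRrM mulrDl mul1r mulVf ?pnatr_eq0 -?lt0n //.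
by rewrite natr1 powR_mulrn ?(ltW p0).
Qed.

(** Union bound: each intersection with some [F g] costs at most [d]. *)
Lemma frequencyI_ge n (E : set (coins n)) (F : nat -> set (coins n)) (d : R) j N :
  (forall g, 1 - d <= frequency R (F g) N) ->
  frequency R E N - j%:R * d <=
  frequency R (E `&` [set w | forall g, (g < j)%N -> F g w]) N.
Proof.
move=> Fd; elim: j => [|j IH].
  by rewrite mul0r subr0; apply: le_frequency => w Ew; split.
set G := E `&` _ in IH.
have : frequency R G N <= frequency R (G `&` F j) N + frequency R (~` F j) N.
  apply: le_trans (frequencyU _ _ _ _); apply: le_frequency => w Gw.
  by have [Fw|nFw] := pselect (F j w); [left|right].
have GF : G `&` F j `<=` E `&` [set w | forall g, (g < j.+1)%N -> F g w].
  move=> w [[Ew Gw] Fw]; split=> // g.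
  by rewrite ltnS leq_eqVlt => /orP[/eqP -> //|]; exact: Gw.
move: (le_frequency R N GF) (Fd j); rewrite frequencyC -natr1 mulrDl mul1r; lra.
Qed.

End RealBounds.

(** * Cells, anchors and blocks *)

Section Separation.
Variables (R : realType) (k m s N : nat).
Hypotheses (k_gt0 : (0 < k)%N) (s_gt0 : (0 < s)%N).
(** Cells have width [W]. The path consists of [k.+1] stretches of [m.+1] cells: the first cell of a
    stretch holds an anchor, the other [m] are candidates for a secure cell. *)
Let W := (4 * s)%N.
Let n := (W * (k.+1 * m.+1))%N.
(* [Y x w v]: with selection [x] and coins [w], node [v] of the path answers
   yes. *)
Variable Y : ('I_n -> bool) -> coins n -> 'I_n -> Prop.
Hypothesis Y_local : forall x x' w w' v,
  (forall u, path_near s u v -> x u = x' u) ->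
  agree_on [pred u | path_near s u v] w w' -> Y x w v -> Y x' w' v.

Definition yes_on (D : 'I_n -> Prop) x : set (coins n) :=
  [set w | forall v, D v -> Y x w v].

Lemma yes_on_depends (D : 'I_n -> Prop) (S : pred 'I_n) x :
  (forall u v, D v -> path_near s u v -> S u) -> depends_on S (yes_on D x).
Proof.
move=> DS w w' ww' Yw v Dv; apply: Y_local (Yw v Dv) => // u r i uv.
by apply: ww'; exact: DS uv.
Qed.

Lemma yes_on_eq (D : 'I_n -> Prop) (S : pred 'I_n) x x' :
  (forall u v, D v -> path_near s u v -> S u) -> (forall u, S u -> x u = x' u) ->
  yes_on D x = yes_on D x'.
Proof.
move=> DS xx'; apply/seteqP; split => w Yw v Dv;
  by apply: Y_local (Yw v Dv) => // u uv; rewrite xx' //; exact: DS uv.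
Qed.

Variables p d : R.
Hypotheses (p_gt0 : 0 < p) (dm : (1 - d) ^+ m < p).
Hypothesis Y_yes : forall x : 'I_n -> bool, (#|[pred v | x v]| <= k)%N ->
  p <= frequency R (yes_on (fun=> True) x) N.

(** The middle half of cell [c]: the margin [s] on both sides keeps everything a core node sees
    inside the cell. *)
Definition core c (v : 'I_n) : bool := (W * c + s <= v < W * c + 3 * s)%N.

Lemma core_near c u v : core c v -> path_near s u v -> (u %/ W)%N = c.
Proof.
by move=> cv uv; apply: cell_div; move: cv uv; rewrite /core /path_near /W; lia.
Qed.

Let none : 'I_n -> bool := fun=> false.

(** Otherwise, by independence, the [m] cores would all say yes with probability at most
    [(1 - d) ^+ m < p], although the empty selection is a yes-instance. *)
Lemma secure_cell off : exists c, (c < m)%N /\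
  1 - d <= frequency R (yes_on (core (off + c)) none) N.
Proof.
apply: contrapT => insecure.
pose E i := yes_on (core (off + i)) none.
(* Truncated subtraction also gives label 0 to the cells before [off]; this only enlarges a
   class. *)
have dE i : depends_on [pred v : 'I_n | (v %/ W - off)%N == i] (E i).
  apply: yes_on_depends => u v cv uv /=.
  by rewrite (core_near cv uv) addKn.
have /(lt_le_trans dm) : p <= \prod_(i < m) frequency R (E i) N.
  rewrite -(frequency_indep R (lab := fun v : 'I_n => (v %/ W - off)%N)) //.
  apply: le_trans (Y_yes (x := none) _) _; first by rewrite eq_card0.
  by apply: le_frequency => w Yw i _ v _; exact: Yw.
rewrite ltNge => /negP; apply.
rewrite -[X in _ ^+ X]card_ord -prodr_const; apply: ler_prod => i _.
rewrite frequency_ge0 /= leNgt; apply/negP => Ei.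
by apply: insecure; exists i; split; [exact: ltn_ord | exact: ltW].
Qed.

Definition anchor (i : nat) : nat := (W * (i * m.+1))%N.

Lemma anchor_lt i : (i < k.+1)%N -> (anchor i < n)%N.
Proof. by move=> ik; rewrite /anchor /n ltn_mul2l ltn_mul2r ik /W; lia. Qed.

Lemma anchor_inj i j : anchor i = anchor j -> i = j.
Proof.
move/eqP; rewrite /anchor eqn_mul2l eqn_mul2r /=.
by case/orP => /eqP; rewrite /W; lia.
Qed.

Let anchor_ord (i : 'I_k.+1) : 'I_n := Ordinal (anchor_lt (ltn_ord i)).

(** For [i] at most [k] one anchor is omitted, a yes-instance; [i = k.+1] omits none and gives the
    no-instance. *)
Definition anchors_but (i : nat) (v : 'I_n) : bool :=
  [exists g : 'I_k.+1, (g != i :> nat) && (v == anchor g :> nat)].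

Lemma card_anchors_but (i : 'I_k.+1) : (#|[pred v | anchors_but i v]| <= k)%N.
Proof.
have ci : #|predC1 i| = k by rewrite cardC1 card_ord.
rewrite -[leqRHS]ci; apply: leq_trans (leq_image_card anchor_ord _).
apply: subset_leq_card; apply/fintype.subsetP => v.
rewrite inE => /existsP[g /andP[gi /eqP vg]].
by apply/fintype.imageP; exists g; [rewrite inE | apply/val_inj].
Qed.

Lemma card_all_anchors : (k < #|[pred v | anchors_but k.+1 v]|)%N.
Proof.
rewrite -[X in (X <= _)%N]card_ord.
have aI : injective anchor_ord by move=> i j [] /anchor_inj /val_inj.
rewrite -(fintype.card_codom aI); apply: subset_leq_card.
apply/fintype.subsetP => _ /codomP[g ->]; rewrite inE; apply/existsP; exists g.
by rewrite eqxx andbT neq_ltn ltn_ord.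
Qed.

(* [c g] is the index of the secure cell chosen between anchors [g] and
   [g + 1]. *)
Section Blocks.
Variable c : nat -> nat.
Hypothesis c_lt : forall g, (c g < m)%N.
Hypothesis c_secure :
  forall g, 1 - d <= frequency R (yes_on (core ((g * m.+1).+1 + c g)) none) N.

Let a g := ((g * m.+1).+1 + c g)%N.

(** The path is cut at the midpoints of the secure cores; a block number counts the cuts at or
    before [v]. *)
Definition block (v : nat) : nat := (\sum_(g < k) (W * a g + 2 * s <= v))%N.

Definition outside_cores (v : 'I_n) : Prop :=
  forall g, (g < k)%N -> ~~ core (a g) v.

(** A core extends [s] nodes to each side of its cut, so a node outside the cores sees no node
    beyond a cut. *)
Lemma block_near u v : outside_cores v -> path_near s u v -> block u = block v.
Proof.
move=> vc uv; apply: eq_bigr => g _; congr nat_of_bool.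
by have := vc g (ltn_ord g); move: uv; rewrite /path_near /core; lia.
Qed.

Lemma secure_between g i :
  if (g < i)%N then (a g < i * m.+1)%N else (i * m.+1 < a g)%N.
Proof.
rewrite /a; case: ltnP => gi; have := c_lt g.
  by have := leq_mul gi (leqnn m.+1); rewrite mulSn; lia.
by have := leq_mul gi (leqnn m.+1); lia.
Qed.

Lemma block_anchor i : (i <= k)%N -> block (anchor i) = i.
Proof.
move=> ik; rewrite -[RHS](sum_ltn_ord ik); apply: eq_bigr => g _; congr nat_of_bool.
have := secure_between g i; case: ltnP => gi /(leq_cell W); rewrite /anchor /W; lia.
Qed.

Lemma block_le v : (block v <= k)%N.
Proof.
rewrite -[leqRHS]muln1 -[X in (X * 1)%N]card_ord -sum_nat_const.
by apply: leq_sum => g _; exact: leq_b1.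
Qed.

Let E i := yes_on (fun v => outside_cores v /\ block v = i) (anchors_but k.+1).

Lemma E_depends i : depends_on [pred v : 'I_n | block v == i] (E i).
Proof.
apply: yes_on_depends => u v [vc vi] uv /=; apply/eqP.
by rewrite (block_near vc uv).
Qed.

(** Anchor [i] lies in block [i], so omitting it changes no other block. *)
Lemma anchors_but_block i (u : 'I_n) :
  block u != i -> anchors_but i u = anchors_but k.+1 u.
Proof.
move=> ui; apply: eq_existsb => g; rewrite [in RHS]neq_ltn ltn_ord /=.
case: (eqVneq (u : nat) (anchor g)) => [ug|]; rewrite ?andbF // andbT.
by apply: contraNneq ui => <-; rewrite ug block_anchor // -ltnS.
Qed.

(** Without anchor [i0] the decider accepts with probability at least [p], and the other blocks
    cannot notice the omission. *)
Lemma prod_blocks_except (i0 : 'I_k.+1) :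
  p <= \prod_(i : 'I_k.+1 | i != i0) frequency R (E i) N.
Proof.
(* Putting the sure event at [i0] turns the partial product into a full one, as [frequency_indep]
   requires. *)
pose F i := if i == i0 :> nat then [set: coins n] else E i.
have dF i : depends_on [pred v : 'I_n | block v == i] (F i).
  by rewrite /F; case: eqP => // _; exact: E_depends.
rewrite big_mkcond /=.
have -> : \prod_(i < k.+1) (if i != i0 then frequency R (E i) N else 1) =
    \prod_(i < k.+1) frequency R (F i) N.
  apply: eq_bigr => i _; rewrite /F -val_eqE /=.
  by case: eqP => // _; rewrite frequencyT.
rewrite -(frequency_indep R (lab := fun v : 'I_n => block v)) //.
apply: le_trans (Y_yes (card_anchors_but i0)) _.
apply: le_frequency => w Yw i _; rewrite /F; case: eqP => // /eqP ii0.
rewrite /E -(@yes_on_eq _ [pred v : 'I_n | block v == i] (anchors_but i0)).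
- by move=> v _; exact: Yw.
- by move=> u v [vc vi] uv /=; rewrite (block_near vc uv) vi.
- by move=> u /= /eqP ui; apply: anchors_but_block; rewrite ui.
Qed.

(** A core sees only its own cell, and no anchor lies in a secure cell. *)
Lemma yes_on_secure_core g :
  yes_on (core (a g)) (anchors_but k.+1) = yes_on (core (a g)) none.
Proof.
apply: (@yes_on_eq _ [pred u : 'I_n | (u %/ W)%N == a g]).
  by move=> u v cv uv /=; rewrite (core_near cv uv).
move=> u /= /eqP ug; apply/negbTE/negP => /existsP[i /andP[_ /eqP ui]].
have W_gt0 : (0 < W)%N by rewrite /W; lia.
move: ug; rewrite ui /anchor mulKn // => ug.
by have := secure_between g i; rewrite -ug ltnn; case: ifP.
Qed.

Lemma all_yes_separated :
  p `^ (1 + k%:R^-1) - k%:R * d <=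
  frequency R (yes_on (fun=> True) (anchors_but k.+1)) N.
Proof.
have Q : p `^ (1 + k%:R^-1) <= \prod_(i < k.+1) frequency R (E i) N.
  apply: prod_except_powR => // [i|]; first exact: frequency_ge0.
  exact: prod_blocks_except.
apply: le_trans (lerB Q (lexx _)) _.
rewrite -(frequency_indep R (lab := fun v : 'I_n => block v)); last exact: E_depends.
have sec g : 1 - d <= frequency R (yes_on (core (a g)) (anchors_but k.+1)) N.
  by rewrite yes_on_secure_core; exact: c_secure.
apply: le_trans (frequencyI_ge _ _ sec) _.
apply: le_frequency => w [Ew Cw] v _.
(* Every node lies in a secure core or is covered by the event of its block. *)
have [[g gk vg]|nv] := pselect (exists2 g, (g < k)%N & core (a g) v).
  exact: Cw gk _ vg.
apply: (Ew (block v)); first by rewrite ltnS block_le.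
by split=> // g gk; apply/negP => vg; apply: nv; exists g.
Qed.

End Blocks.

Lemma separation : exists x : 'I_n -> bool, (k < #|[pred v | x v]|)%N /\
  p `^ (1 + k%:R^-1) - k%:R * d <= frequency R (yes_on (fun=> True) x) N.
Proof.
have [c hc] := choice (fun g => secure_cell (g * m.+1).+1).
exists (anchors_but k.+1); split; first exact: card_all_anchors.
by apply: (@all_yes_separated c) => g; have [] := hc g.
Qed.

End Separation.

(** * Conclusion for sublinear running times *)

Theorem theorem3p1 (R : realType) (k : nat) (t : triplet -> R)
    (hk : (1 <= k)%N) (ht : sublinear t) :
  (B k.+1 (fun=> 0 : R) `\` B k t) !=set0.
Proof.
exists (selection_language k); split; first exact: selection_language_B.
move=> [p [q [/andP[p0 p1] /andP[q0 q1] pq [A dec within]]]].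
have pk1 : p `^ (1 + k%:R^-1) <= 1.
  suff : p `^ (1 + k%:R^-1) <= 1 `^ (1 + k%:R^-1) by rewrite powR1.
  by rewrite ge0_ler_powR ?nnegrE ?addr_ge0 ?(ltW p0).
(* Dividing the excess by [k.+1] rather than [k] leaves a slack [d] after the loss [k * d]. *)
pose d := (p `^ (1 + k%:R^-1) + q - 1) / k.+1%:R.
have d_gt0 : 0 < d by rewrite divr_gt0 // subr_gt0.
have dk : d * k%:R + d = p `^ (1 + k%:R^-1) + q - 1.
  by rewrite -{2}[d]mulr1 -mulrDr natr1 divfK // pnatr_eq0.
have dk1 : d <= d * k%:R by rewrite ler_peMr ?(ltW d_gt0) // ler1n.
have d_lt1 : d < 1 by lra.
have [m dm] : exists m, (1 - d) ^+ m < p by apply: expr_lt_exists => //; lra.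
(* The path will have [C * s] nodes, so a running time of at most [1 / C] per node means at most [s]
   rounds. *)
pose C := (4 * (k.+1 * m.+1))%N.
have C_gt0 : (0 : R) < C%:R by rewrite ltr0n.
have [|n0 hn0] := ht C%:R^-1; first by rewrite invr_gt0.
pose s := n0.+1.
pose n := (4 * s * (k.+1 * m.+1))%N.
have nE : n = (C * s)%N by rewrite /n /C; lia.
have n_gt0 : (0 < n)%N by rewrite !muln_gt0.
pose T (x : 'I_n -> bool) := path_triplet n_gt0 (fun v => x v : nat).
have rounds x w v r b : @terminates A (T x) w v r b -> (r <= s)%N.
  move=> /within -/(_ (fun _ => I)) rt.
  have /hn0 : (n0 <= nnodes (T x))%N by rewrite [nnodes _]nE; nia.
  rewrite [nnodes _]nE ler_pdivrMr ?ltr0n ?muln_gt0 // natrM mulKf ?gt_eqF //.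
  by move=> /(le_trans (ler_norm _)) /(le_trans rt); rewrite ler_nat.
pose Y x w v := @outputs A (T x) w v true.
have Y_local x x' w w' v : (forall u, path_near s u v -> x u = x' u) ->
    agree_on [pred u | path_near s u v] w w' -> Y x w v -> Y x' w' v.
  move=> xx' ww'; apply: (@outputs_eq _ _ _ _ _ _ _ _ s); last exact: rounds.
  move=> r rs; have nearW u : path_near r u v -> path_near s u v.
    by rewrite /path_near; lia.
  apply: path_run_local => [u /nearW /xx' -> //|u i j /= /nearW uv].
  exact: ww'.
have [N YN] : exists N, forall x, depends_upto N (@all_yes A (T x)).
  have [f hf] := choice (fun x => coins_bounded A (T x) s).
  (* One [N] serves all selections: the maximum runs over finite functions, and every selection
     equals one by extensionality. *)
  exists (\max_(x : {ffun 'I_n -> bool}) f x)%N => x w w' ww' yes v.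
  apply: outputs_eq (yes v); last exact: rounds.
  move=> r rs; apply: (hf x) => // u i j hi hj; apply: ww'.
    apply: leq_trans hi _.
    have -> : x = finfun x by apply/funext => z; rewrite ffunE.
    exact: (leq_bigmax (F := fun x : {ffun 'I_n -> bool} => f x)).
  apply: leq_trans hj _.
  have -> : x = finfun x by apply/funext => z; rewrite ffunE.
  exact: (leq_bigmax (F := fun x : {ffun 'I_n -> bool} => f x)).
have selT x : selected (T x) = #|[pred v | x v]|.
  by apply: eq_card => v; rewrite !inE /=; case: (x v).
have yesT x : yes_on Y (fun=> True) x = @all_yes A (T x).
  by apply/seteqP; split => w yes v; [exact: yes | move=> _; exact: yes].
have Y_yes x : (#|[pred v | x v]| <= k)%N ->
    p <= frequency R (yes_on Y (fun=> True) x) N.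
  move=> xk; have [//|_ yes _] := dec (T x).
  rewrite yesT -(Pr_frequency R (YN x)); apply: yes.
  by rewrite /= /at_most_selected /= selT.
have [x [kx]] := separation hk (ltn0Sn _) Y_local p0 dm Y_yes.
have [//|tot _ no] := dec (T x).
have : q <= Pr R (@some_no A (T x)).
  by apply: no; rewrite /= /at_most_selected /= selT; apply/negP; rewrite -ltnNge.
rewrite some_noE // (Pr_frequency R (N := N)); last first.
  move=> w w' ww' nyes yes; apply: nyes; apply: YN yes.
  exact: agree_upto_sym.
(* The two bounds give [p^(1+1/k) + q - 1 <= k * d], contrary to [dk] and [d_gt0]. *)
by rewrite yesT frequencyC; lra.
Qed.
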